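(* Let $n\ge 3$ be an integer and let $t\in[-1,0]$. Put \[ p := \frac{8n^2t^4(2n-1) - 9n^2t^3(n-1) + (2nt^2 -3t + 4)(7n+1)}{2(1-t)\bigl(1+7n - 2n^2t^3(2n-1)\bigr)} \qquad\text{and}\qquad f(n,t) := \frac{p^2\, n(1-t)^2}{2(nt^2+1)}. \] Then \[ \alpha(n,t)\ \le\ \lfloor f(n,t)\rfloor\ \le\ \left\lfloor \frac{(16t-9)^2}{128t^2}\right\rfloor, \] where for $t=0$ the rightmost quantity is read as $+\infty$ (so that only the first inequality is asserted there).
   Context: $S^{n-1}=\{x\in\mathbb{R}^n:\|x\|=1\}$ and $x\cdot y$ is the Euclidean inner product. For $t\in[-1,1)$, a set $S\subseteq S^{n-1}$ is $t$-almost-equiangular if every three distinct points $x,y,z\in S$ satisfy $t\in\{x\cdot y,\,x\cdot z,\,y\cdot z\}$. $\alpha(n,t)$ denotes the maximum cardinality of a $t$-almost-equiangular set in $S^{n-1}$. *)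

(* Defs.v *)
From mathcomp Require Export all_boot all_order all_algebra.
From mathcomp Require Export boolp classical_sets functions cardinality reals.

Set Implicit Arguments.
Unset Strict Implicit.
Unset Printing Implicit Defensive.

Import Order.TTheory GRing.Theory Num.Theory.
Local Open Scope classical_set_scope.
Local Open Scope card_scope.
Local Open Scope ring_scope.

Definition dotp (R : realType) (n : nat) (x y : 'rV[R]_n) : R :=
  \sum_(i < n) x 0 i * y 0 i.

(* The library's norm on 'rV[R]_n is the sup norm, hence this definition. *)
Definition enorm (R : realType) (n : nat) (x : 'rV[R]_n) : R :=
  Num.sqrt (dotp x x).

Definition unit_sphere (R : realType) (n : nat) : set 'rV[R]_n :=
  [set x | enorm x = 1].

Definition almost_equiangular (R : realType) (n : nat) (t : R)
    (S : set 'rV[R]_n) : Prop :=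
  S `<=` @unit_sphere R n /\
  forall x y z : 'rV[R]_n, S x -> S y -> S z ->
    x <> y -> x <> z -> y <> z ->
    [\/ t = dotp x y, t = dotp x z | t = dotp y z].

(* S is not assumed finite in [almost_equiangular], so the second clause also
   excludes infinite almost-equiangular sets. *)
Definition is_max_cardinality (R : realType) (n : nat) (t : R) (m : nat) :
    Prop :=
  (exists S : set 'rV[R]_n, almost_equiangular t S /\ S #= `I_m) /\
  (forall S : set 'rV[R]_n, almost_equiangular t S -> S #<= `I_m).

(* The value is 0 by convention if no maximum exists; a bound on [alpha n t] is
   meaningful only together with [is_max_cardinality n t (alpha n t)]. *)
Definition alpha (R : realType) (n : nat) (t : R) : nat :=
  xget 0%N [set m | is_max_cardinality n t m].

Definition pbound (R : realType) (n : nat) (t : R) : R :=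
  let N : R := n%:R in
  (8 * N ^+ 2 * t ^+ 4 * (2 * N - 1) - 9 * N ^+ 2 * t ^+ 3 * (N - 1)
     + (2 * N * t ^+ 2 - 3 * t + 4) * (7 * N + 1))
  / (2 * (1 - t) * (1 + 7 * N - 2 * N ^+ 2 * t ^+ 3 * (2 * N - 1))).

Definition fbound (R : realType) (n : nat) (t : R) : R :=
  let N : R := n%:R in
  (pbound n t ^+ 2 * N * (1 - t) ^+ 2) / (2 * (N * t ^+ 2 + 1)).

(* Main.v *)
Require Import Defs.
From mathcomp Require Import ring lra zify.
Import Order.TTheory GRing.Theory Num.Theory.
Local Open Scope ring_scope.

(** Let [x_1, ..., x_m] be the points of a finite [t]-almost-equiangular set,
    and put [a := -t], [b := 1 + a].  Let [G] be the Gram matrix and [J] the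
    all-ones matrix.  The matrix [B := G + a J - b I] has zero diagonal, and its
    [(i, j)] entry is [x_i . x_j - t] off the diagonal; so the hypothesis says
    that no three indices carry three nonzero entries, that is [tr B^3 = 0].
    This generalizes the argument for almost orthogonal sets, the case [t = 0].

    Since [G] is positive semidefinite, [tr (G Z^2) >= 0] for every symmetric
    [Z]; take [Z := G + (3/2) a J - c b I].  Subtracting [tr B^3] cancels
    [tr G^3] and the sum of the entries of [G^2], and what is left involves only
    [tr G^2 >= m^2/n] and the nonnegative sum of the entries of [G].  This gives
    one quadratic inequality in [m] for each admissible value of [c]
    ([psd_trace_inequality]).  Two values suffice:

      - [c = 2]:    [a (a m - 2 b)^2 + b m (1/n + a^2) <= 2 b^3];
      - [c = 3/2]:  [a (a m - 3 b/2)^2 <= b^3/4], available when [a m >= 2 b].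

    The number [p] equals [2 - d] with a defect [d >= 0] that has a double zero
    at [t = -1/n] ([pboundE]), and [m > f(n,t)] means [p^2 < X] for
    [X := 2 m (1 + n a^2) / (n b^2)].  If [n^2 a^3 <= 1], this contradicts the
    inequality for [c = 2] ([contradicts_first_inequality]); if [n^2 a^3 >= 1],
    it contradicts the one for [c = 3/2] ([contradicts_second_inequality]).  The
    substitution [s := sqrt a], [u := n s^3] makes both cases polynomial:
    [n^2 a^3 = u^2], [n a^2 = s u], and [b d = (u - s)^2 F] with [F <= 1/2].

    The bound is finite, so almost-equiangular sets are finite, of bounded size,
    and a maximum exists.  The comparison of [f(n,t)] with
    [(16 t - 9)^2 / (128 t^2)] is a polynomial inequality in [n] and [a], which
    is very tight at [n = 3], [a = 19/20]; it is certified by nonnegative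
    Bernstein coefficients for [n = 3, 4], and follows from a rational lower
    bound for a square root for [n >= 5]. *)

(** * Trace inequalities for Gram matrices *)

Lemma mxtrace_mul_tr_ge0 {R : realFieldType} {m k : nat} (C : 'M[R]_(m, k)) :
  0 <= \tr (C *m C^T).
Proof.
apply: sumr_ge0 => i _; rewrite mxE; apply: sumr_ge0 => j _.
by rewrite mxE -expr2 sqr_ge0.
Qed.

(** The squared Frobenius distance from [W] to the scalar matrix with the same
    trace is nonnegative. *)
Lemma sqr_mxtrace_le {R : realFieldType} {n : nat} (W : 'M[R]_n) :
  (\tr W) ^+ 2 <= n%:R * \tr (W *m W^T).
Proof.
case: n W => [W|n W]; first by rewrite /mxtrace big_ord0 expr0n mul0r.
have := mxtrace_mul_tr_ge0 (W - (\tr W / n.+1%:R)%:M).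
rewrite linearB /= tr_scalar_mx mulmxBl !mulmxBr mul_scalar_mx !mul_mx_scalar.
rewrite scale_scalar_mx !linearB /= !mxtraceZ mxtrace_scalar mxtrace_tr.
move: (\tr W) (\tr (W *m _)) => T Q; rewrite -[(_ * _) *+ _]mulr_natr.
have : (n.+1%:R : R) > 0 by rewrite ltr0n.
move: (n.+1%:R : R) => N N0; have Nn0 : N != 0 by rewrite gt_eqF.
have [q ->] : exists q, T = N * q by exists (T / N); field.
have -> : N * q / N = q by field.
move=> h.
by have := mulr_ge0 (ltW N0) h; lra.
Qed.

(** The matrix [G + (3/2) a J - c b I] is chosen so that subtracting [tr B^3]
    cancels both [tr G^3] and the sum of the entries of [G^2]: neither has a
    usable upper bound.  The remaining multiple of the sum of the entries of [G]
    has the right sign exactly when [4 b (2 - c) <= a m]. *)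
Lemma psd_trace_inequality {R : realFieldType} {m : nat} (G : 'M[R]_m)
    (N a b c : R) :
  (forall k (Z : 'M[R]_(m, k)), 0 <= \tr (Z^T *m G *m Z)) ->
  G^T = G -> \tr G = m%:R -> m%:R ^+ 2 <= N * \tr (G *m G) ->
  let B := G + a *: const_mx 1 - b%:M in \tr (B *m B *m B) = 0 ->
  0 <= N -> 0 <= a -> 0 <= b -> 3 <= 2 * c -> 4 * b * (2 - c) <= a * m%:R ->
  (2 * c - 3) * b * m%:R ^+ 2
    <= N * m%:R * (b ^+ 2 * (c ^+ 2 - 3 + b - 3 * a)
         + 3 * a ^+ 2 * b * m%:R - a ^+ 3 * m%:R ^+ 2).
Proof.
move=> psd GT trG trG2 B trB N0 a0 b0 c32.
pose J : 'M[R]_m := const_mx 1.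
pose e : 'cV[R]_m := const_mx 1.
have Je : J = e *m e^T.
  by apply/matrixP => i j; rewrite !mxE big_ord1 !mxE mulr1.
have JJ : J *m J = m%:R *: J.
  apply/matrixP => i j; rewrite !mxE.
  under eq_bigr do rewrite !mxE mulr1.
  by rewrite sumr_const card_ord mulr1.
have trJ : \tr J = m%:R.
  by rewrite /mxtrace; under eq_bigr do rewrite mxE; rewrite sumr_const card_ord.
have sigma0 : 0 <= \tr (G *m J).
  by rewrite Je mxtrace_mulC -mulmxA mxtrace_mulC; exact: psd.
have trI : \tr (1%:M : 'M[R]_m) = m%:R by rewrite mxtrace_scalar.
move: trB psd trI; rewrite {}/B -/J.
move: (m%:R : R) trG trG2 JJ trJ => M trG trG2 JJ trJ trB psd trI mu_ge.
have trGJG : \tr (G *m J *m G) = \tr (G *m G *m J).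
  by rewrite mxtrace_mulC mulmxA.
have trJGG : \tr (J *m G *m G) = \tr (G *m G *m J).
  by rewrite -mulmxA mxtrace_mulC.
have trJG : \tr (J *m G) = \tr (G *m J) by rewrite mxtrace_mulC.
have trGJJ : \tr (G *m J *m J) = M * \tr (G *m J).
  by rewrite -mulmxA JJ -scalemxAr mxtraceZ.
have trJGJ : \tr (J *m G *m J) = M * \tr (G *m J).
  by rewrite -mulmxA mxtrace_mulC trGJJ.
have trJJG : \tr (J *m J *m G) = M * \tr (G *m J).
  by rewrite JJ -scalemxAl mxtraceZ trJG.
have trJJ : \tr (J *m J) = M ^+ 2 by rewrite JJ mxtraceZ trJ.
have trJJJ : \tr (J *m J *m J) = M ^+ 3.
  by rewrite JJ -scalemxAl mxtraceZ trJJ.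
have trZ (K L : 'M[R]_m) (x y : R) : \tr (K *m (G + x *: J - y%:M) *m L) =
    \tr (K *m G *m L) + x * \tr (K *m J *m L) - y * \tr (K *m L).
  rewrite mulmxBr mulmxDr -scalemxAr mul_mx_scalar mulmxBl mulmxDl -!scalemxAl.
  by rewrite raddfB raddfD /= !mxtraceZ.
have trZr (K : 'M[R]_m) (x y : R) : \tr (K *m (G + x *: J - y%:M)) =
    \tr (K *m G) + x * \tr (K *m J) - y * \tr K.
  by rewrite -[X in \tr X]mulmx1 trZ !mulmx1.
have trZl (L : 'M[R]_m) (x y : R) : \tr ((G + x *: J - y%:M) *m L) =
    \tr (G *m L) + x * \tr (J *m L) - y * \tr L.
  by rewrite -[X in \tr (X *m _)]mul1mx trZ !mul1mx.
have trB1 : \tr (G + a *: J - b%:M) = M + a * M - b * M.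
  by rewrite -[X in \tr X]mul1mx trZr !mul1mx trI trG trJ.
have GZ : 0 <= \tr (G *m (G + (3 / 2 * a) *: J - (c * b)%:M)
                     *m (G + (3 / 2 * a) *: J - (c * b)%:M)).
  rewrite mxtrace_mulC mulmxA.
  have := psd _ (G + (3 / 2 * a) *: J - (c * b)%:M).
  rewrite (_ : (_ - _)^T = G + (3 / 2 * a) *: J - (c * b)%:M) //.
  by apply/matrixP => i j; rewrite -{1}GT !mxE eq_sym.
move: GZ trB; rewrite -(mulmxA (_ - _)) trZl !mulmxA !(trZ, trZr).
rewrite !trZl trB1 trGJG trJGG trJG trGJJ trJGJ trJJG trJJ trJJJ trG trJ.
move: sigma0 trG2; move: (\tr (G *m G *m G)) (\tr (G *m G *m J)) (\tr (G *m G)).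
move: (\tr (G *m J)) => sg T3 q T2 sigma0 trG2 GZ trB.
have cross : 0 <= a * sg * (3 * b * (c - 2) + 3 / 4 * a * M).
  by apply: mulr_ge0; [exact: mulr_ge0 | lra].
have key : (2 * c - 3) * b * T2 <= M * (b ^+ 2 * (c ^+ 2 - 3 + b - 3 * a)
         + 3 * a ^+ 2 * b * M - a ^+ 3 * M ^+ 2) by lra.
have c3 : 0 <= (2 * c - 3) * b by apply: mulr_ge0 => //; lra.
have := ler_wpM2l c3 trG2; have := ler_wpM2l N0 key; lra.
Qed.

(** The Gram matrix of an almost-equiangular family satisfies the hypotheses of
    [psd_trace_inequality]: among the entries of [B] at [(i, k)], [(k, j)] and
    [(j, i)] one always vanishes, and [G] and the [n]-by-[n] matrix [A^T A] have
    the same trace and the same trace of the square. *)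
Lemma almost_equiangular_family_inequality {R : realType} {m n : nat} (t c : R)
    (x : 'I_m -> 'rV[R]_n) :
  (forall i, dotp (x i) (x i) = 1) ->
  (forall i j k, i != j -> i != k -> j != k ->
    [\/ t = dotp (x i) (x j), t = dotp (x i) (x k) | t = dotp (x j) (x k)]) ->
  -1 <= t <= 0 -> 3 <= 2 * c -> 4 * (1 - t) * (2 - c) <= - t * m%:R ->
  (2 * c - 3) * (1 - t) * m%:R ^+ 2
    <= n%:R * m%:R * ((1 - t) ^+ 2 * (c ^+ 2 - 2 + 2 * t)
         + 3 * t ^+ 2 * (1 - t) * m%:R + t ^+ 3 * m%:R ^+ 2).
Proof.
move=> x1 xt tI c32 mu_ge.
pose A := \matrix_(i < m) x i; pose G := A *m A^T.
have GE i j : G i j = dotp (x i) (x j).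
  by rewrite mxE; apply: eq_bigr => k _; rewrite !mxE.
have dotpC i j : dotp (x i) (x j) = dotp (x j) (x i).
  by apply: eq_bigr => k _; rewrite mulrC.
have GT : G^T = G by apply/matrixP => i j; rewrite mxE !GE dotpC.
have trG : \tr G = m%:R.
  rewrite /mxtrace; under eq_bigr do rewrite GE x1.
  by rewrite sumr_const card_ord.
have psd k (Z : 'M[R]_(m, k)) : 0 <= \tr (Z^T *m G *m Z).
  have := mxtrace_mul_tr_ge0 (Z^T *m A).
  by rewrite trmx_mul trmxK !mulmxA.
have trG2 : m%:R ^+ 2 <= n%:R * \tr (G *m G).
  have := sqr_mxtrace_le (A^T *m A).
  rewrite mxtrace_mulC -/G trG trmx_mul trmxK.
  by rewrite -[A^T *m A *m _]mulmxA mxtrace_mulC -!mulmxA mulmxA.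
have trB : let B := G + (- t) *: const_mx 1 - (1 - t)%:M in
    \tr (B *m B *m B) = 0.
  have ME (H : 'M[R]_m) i j : (H + (- t) *: const_mx 1 - (1 - t)%:M) i j
      = H i j - t - (1 - t) *+ (i == j) by rewrite !mxE mulr1.
  move=> B; have BE i j : i != j -> B i j = dotp (x i) (x j) - t.
    by move=> ij; rewrite ME GE (negPf ij) subr0.
  have BD i : B i i = 0.
    by rewrite ME GE x1 eqxx subrr.
  rewrite /mxtrace big1 // => i _; rewrite mxE big1 // => j _.
  rewrite mxE mulr_suml big1 // => k _.
  have [->|ik] := eqVneq i k; first by rewrite BD !mul0r.
  have [->|kj] := eqVneq k j; first by rewrite BD mulr0 mul0r.
  have [->|ij] := eqVneq i j; first by rewrite BD mulr0.
  rewrite (BE i k) // (BE k j) // (BE j i) 1?eq_sym // (dotpC j i).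
  case: (xt i k j ik ij kj) => <-; rewrite subrr ?mulr0 ?mul0r //.
have /andP[t1 t0] := tI.
have := psd_trace_inequality _ _ _ _ c psd GT trG trG2 trB.
rewrite ler0n; move=> /(_ isT) H; apply: le_trans (H _ _ _ _) _; try lra.
Qed.

(** * The two contradictions *)

(** Only [X <= 4] needs an argument.  With [X = 4 - xi], the hypotheses give
    [0 <= b xi < 4 (u - s)^2 F], which is at most [2 (u - s)^2].  The term
    [a (a M - 2 b)^2] is [z^2] for [z := s^3 M - 2 s b], and it suffices that
    [b |u - s| <= |z|].  Indeed, [(1 + s u) z = b (2 (u - s) - b xi u / 2)]: if
    [s <= u], the second term costs at most [(u - s) (1 - s u)] because
    [u <= 1]; if [u <= s], both terms have the same sign. *)
Lemma contradicts_first_inequality {R : realFieldType} (N M s u d F X : R) :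
  let a := s ^+ 2 in let b := 1 + a in
  0 < N -> 0 <= s <= 1 -> 0 <= u <= 1 -> u = N * s ^+ 3 -> 2 * F <= 1 ->
  b * d = (u - s) ^+ 2 * F -> X * N * b ^+ 2 = 2 * M * (1 + s * u) ->
  (2 - d) ^+ 2 < X ->
  N * (b ^+ 2 * (2 - 2 * a) + 3 * a ^+ 2 * b * M - a ^+ 3 * M ^+ 2) < b * M.
Proof.
move=> a b N0 /andP[s0 s1] /andP[u0 u1] uE F2 dE XE dX.
have a0 : 0 <= a by apply: sqr_ge0.
have b0 : 0 < b by rewrite /b; lra.
have su0 : 0 <= s * u by apply: mulr_ge0.
have su1 : s * u <= 1 by apply: mulr_ile1.
set z := s ^+ 3 * M - 2 * s * b.
suff zX : 0 < b ^+ 3 * (X - 4) / 2 + z ^+ 2.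
  rewrite -subr_gt0.
  have -> : b * M - N * (b ^+ 2 * (2 - 2 * a) + 3 * a ^+ 2 * b * M
      - a ^+ 3 * M ^+ 2) = N * (b ^+ 3 * (X - 4) / 2 + z ^+ 2).
    have -> : N * (b ^+ 3 * (X - 4) / 2 + z ^+ 2)
        = b / 2 * (X * N * b ^+ 2) + N * (z ^+ 2 - 2 * b ^+ 3) by field.
    by rewrite XE uE /z /b /a; field.
  exact: mulr_gt0.
have [X4|X4] := ltP 4 X.
  apply: ltr_pwDl; last exact: sqr_ge0.
  by rewrite divr_gt0 // mulr_gt0 ?exprn_gt0 //; lra.
have [e eE] : {e | e = u - s} by exists (u - s).
rewrite -eE in dE; have [y yE] : {y | y = b * (4 - X)} by exists (b * (4 - X)).
have y2e : y < 2 * e ^+ 2.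
  have : y < b * (4 * d).
    by rewrite yE ltr_pM2l //; have := sqr_ge0 d; lra.
  have := ler_wpM2l (sqr_ge0 e) F2; lra.
have y0 : 0 <= y by rewrite yE; apply: mulr_ge0; [exact: ltW|lra].
have zE : (1 + s * u) * z = b * (2 * e - y * u / 2).
  have -> : (1 + s * u) * z = s ^+ 3 * (2 * M * (1 + s * u)) / 2
     - (1 + s * u) * 2 * s * b by rewrite /z; field.
  by rewrite -XE yE eE uE /b /a; field.
have ez : b * `|e| <= `|z|.
  rewrite -(@ler_pM2l _ (1 + s * u)); last by lra.
  rewrite -[X in _ <= X * _]gtr0_norm; last by lra.
  rewrite -normrM zE normrM (gtr0_norm b0) mulrCA ler_pM2l //.
  have [eu|eu] := ger0P e.
    have : y * u / 2 <= e * (e * u).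
      by have := ler_wpM2r u0 (ltW y2e); lra.
    rewrite (_ : e * (e * u) = e * (1 - s * u) - e * (1 - u ^+ 2)); last first.
      by rewrite eE; ring.
    have : 0 <= e * (1 - u ^+ 2).
      by apply: mulr_ge0 => //; rewrite subr_ge0 expr_le1.
    by move=> h1 h2; apply: le_trans (ler_norm _); lra.
  have : 0 <= y * u / 2 by rewrite divr_ge0 // mulr_ge0.
  have ne : 0 <= - e by rewrite oppr_ge0 ltW.
  have := ler_wpM2r ne su1.
  by move=> h1 h2; rewrite -normrN; apply: le_trans (ler_norm _); lra.
have : (b * e) ^+ 2 <= z ^+ 2.
  have : (b * `|e|) ^+ 2 <= `|z| ^+ 2.
    by rewrite ler_sqr ?nnegrE //; apply: mulr_ge0 => //; exact: ltW.
  by rewrite exprMn !real_normK ?num_real // -exprMn.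
have : b ^+ 2 * y < b ^+ 2 * (2 * e ^+ 2) by rewrite ltr_pM2l ?exprn_gt0.
rewrite yE; lra.
Qed.

Lemma chord_le_concave {R : realFieldType} (q0 q1 q2 L s : R) :
  0 <= q2 -> 0 <= s <= L -> 0 < L ->
  0 <= q0 -> 0 <= q0 + q1 * L - q2 * L ^+ 2 -> 0 <= q0 + q1 * s - q2 * s ^+ 2.
Proof.
move=> q20 /andP[s0 sL] L0 h0 hL; rewrite -(@pmulr_rge0 _ L) //.
have -> : L * (q0 + q1 * s - q2 * s ^+ 2) = (L - s) * q0
   + s * (q0 + q1 * L - q2 * L ^+ 2) + q2 * (L * (s * (L - s))) by ring.
have Ls : 0 <= L - s by rewrite subr_ge0.
by rewrite !addr_ge0 // !mulr_ge0 // ltW.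
Qed.

(** The bound on [F] depends on the range of [u], because [F] decreases with
    [N] while [u] is fixed.  For [u <= 3] one uses [3 <= N], and then
    [s^3 <= u / 3] and the tangent line of [s^3] at [s = 7/10] bound [s] by a
    linear function of [u], sharp enough at [u = 1]; for [u >= 3] one
    uses [u <= N], a consequence of [s <= 1].  In both ranges the inequality to
    prove is concave in [s], so the two extreme values of [s] suffice. *)
Lemma defect_bound {R : realFieldType} (N s u F : R) :
  3 <= N -> 0 < s <= 1 -> 1 <= u -> u = N * s ^+ 3 -> 0 <= F ->
  F * (2 * (7 * N + 1 + 2 * u ^+ 2 * (2 * N - 1))) = 7 * N + 1 ->
  56 * u ^+ 2 * (u - s) ^+ 2 * F <= 55 * u ^+ 2 - s ^+ 2 * u ^+ 2 - 64 * s * u - 8.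
Proof.
move=> N3 /andP[s0 s1] u1 uE F0 FE.
have s30 : 0 < s ^+ 3 by rewrite exprn_gt0.
have us0 : 0 <= 56 * u ^+ 2 * (u - s) ^+ 2.
  by rewrite mulr_ge0 ?sqr_ge0 // mulr_ge0 ?sqr_ge0.
have u20 : 0 <= u ^+ 2 by exact: sqr_ge0.
suff [K [k [K0 FK HK]]] : exists K k, [/\ 0 < K, F * K <= k &
   56 * u ^+ 2 * (u - s) ^+ 2 * k
     <= K * (55 * u ^+ 2 - s ^+ 2 * u ^+ 2 - 64 * s * u - 8)].
  rewrite -(ler_pM2l K0); apply: le_trans HK.
  by have := ler_wpM2l us0 FK; lra.
have [u3|u3] := lerP u 3.
  exists (22 + 10 * u ^+ 2), 11; split; first by lra.
    have D0 : 0 < 7 * N + 1 + 2 * u ^+ 2 * (2 * N - 1).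
      have : 0 <= u ^+ 2 * (2 * N - 1) by apply: mulr_ge0 => //; lra.
      lra.
    rewrite -(ler_pM2r D0).
    have : 0 <= u ^+ 2 * (N - 3) by apply: mulr_ge0 => //; lra.
    have -> : F * (22 + 10 * u ^+ 2) * (7 * N + 1 + 2 * u ^+ 2 * (2 * N - 1)) =
       (F * (2 * (7 * N + 1 + 2 * u ^+ 2 * (2 * N - 1)))) * (11 + 5 * u ^+ 2) by ring.
    rewrite FE; lra.
  have sL : s <= 7 / 15 + 100 / 441 * u.
    have : 3 * s ^+ 3 <= u by rewrite uE ler_pM2r.
    have : 0 <= (s - 7 / 10) ^+ 2 * (s + 14 / 10).
      by apply: mulr_ge0; [exact: sqr_ge0|lra].
    lra.
  have L0 : 0 < 7 / 15 + 100 / 441 * u by lra.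
  have sI : 0 <= s <= 7 / 15 + 100 / 441 * u by rewrite sL ltW.
  have := chord_le_concave (2 * (11 + 5 * u ^+ 2) * (55 * u ^+ 2 - 8) - 616 * u ^+ 4)
     (1232 * u ^+ 3 - 128 * u * (11 + 5 * u ^+ 2))
     (2 * (11 + 5 * u ^+ 2) * u ^+ 2 + 616 * u ^+ 2) _ s _ sI L0.
  have [v vE] : {v | u = v + 1} by exists (u - 1); lra.
  have v0 : 0 <= v by lra.
  have v2 : 0 <= 2 - v by lra.
  have v4 : 0 <= v ^+ 4 * (2 - v) by rewrite mulr_ge0 // exprn_ge0.
  have v5 : 0 <= v ^+ 5 * (2 - v) by rewrite mulr_ge0 // exprn_ge0.
  have [w2 w3 w4] : [/\ 0 <= v ^+ 2, 0 <= v ^+ 3 & 0 <= v ^+ 4].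
    by rewrite !exprn_ge0.
  have q0 : 0 <= (u ^+ 2 - 1) * (9 - u ^+ 2).
    by rewrite mulr_ge0 // subr_ge0; nra.
  have q2 : 0 <= 2 * (11 + 5 * u ^+ 2) * u ^+ 2 + 616 * u ^+ 2.
    by have := mulr_ge0 u20 u20; lra.
  move=> /(_ q2) H.
  have /H {}H : 0 <= 2 * (11 + 5 * u ^+ 2) * (55 * u ^+ 2 - 8) - 616 * u ^+ 4.
    rewrite (_ : _ - _
      = 66 * ((u ^+ 2 - 1) * (9 - u ^+ 2)) + 470 * u ^+ 2 + 418); [lra|ring].
  have /H {}H : 0 <= 2 * (11 + 5 * u ^+ 2) * (55 * u ^+ 2 - 8) - 616 * u ^+ 4
    + (1232 * u ^+ 3 - 128 * u * (11 + 5 * u ^+ 2)) * (7 / 15 + 100 / 441 * u)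
    - (2 * (11 + 5 * u ^+ 2) * u ^+ 2 + 616 * u ^+ 2)
      * (7 / 15 + 100 / 441 * u) ^+ 2.
    by rewrite vE; lra.
  lra.
have sI : 0 <= s <= 1 by rewrite s1 ltW.
have Nu : u <= N.
  have s31 : s ^+ 3 <= 1 by rewrite exprn_ile1 // ltW.
  by rewrite uE ger_pMr //; lra.
exists (2 * (7 * u + 1 + 2 * u ^+ 2 * (2 * u - 1))), (7 * u + 1); split.
- have : 0 <= u ^+ 2 * (2 * u - 1) by apply: mulr_ge0 => //; lra.
  lra.
- have D0 : 0 < 7 * N + 1 + 2 * u ^+ 2 * (2 * N - 1).
    have : 0 <= u ^+ 2 * (2 * N - 1) by apply: mulr_ge0 => //; lra.
    lra.
  rewrite -(ler_pM2r D0).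
  have : 0 <= u ^+ 2 * (N - u) by apply: mulr_ge0 => //; lra.
  have -> : F * (2 * (7 * u + 1 + 2 * u ^+ 2 * (2 * u - 1)))
      * (7 * N + 1 + 2 * u ^+ 2 * (2 * N - 1)) =
     (F * (2 * (7 * N + 1 + 2 * u ^+ 2 * (2 * N - 1))))
       * (7 * u + 1 + 2 * u ^+ 2 * (2 * u - 1)) by ring.
  rewrite FE; lra.
have := chord_le_concave
   (2 * (4 * u ^+ 3 - 2 * u ^+ 2 + 7 * u + 1) * (55 * u ^+ 2 - 8)
      - 56 * u ^+ 4 * (7 * u + 1))
   (112 * u ^+ 3 * (7 * u + 1)
      - 128 * u * (4 * u ^+ 3 - 2 * u ^+ 2 + 7 * u + 1))
   (2 * (4 * u ^+ 3 - 2 * u ^+ 2 + 7 * u + 1) * u ^+ 2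
      + 56 * u ^+ 2 * (7 * u + 1)) _ s _ sI ltr01.
have [v vE] : {v | u = v + 3} by exists (u - 3); lra.
have v0 : 0 <= v by lra.
have [w2 w3 w4 w5] : [/\ 0 <= v ^+ 2, 0 <= v ^+ 3, 0 <= v ^+ 4 & 0 <= v ^+ 5].
  by rewrite !exprn_ge0.
move=> H; rewrite -subr_ge0.
have /H {}H : 0 <= 2 * (4 * u ^+ 3 - 2 * u ^+ 2 + 7 * u + 1) * u ^+ 2
      + 56 * u ^+ 2 * (7 * u + 1) by rewrite vE; lra.
have /H {}H : 0 <= 2 * (4 * u ^+ 3 - 2 * u ^+ 2 + 7 * u + 1) * (55 * u ^+ 2 - 8)
      - 56 * u ^+ 4 * (7 * u + 1) by rewrite vE; lra.
apply: le_trans (H _) _; last by lra.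
by rewrite vE; lra.
Qed.

(** Write [mu := a M / b].  The defect bound becomes
    [(7 w + 1) (1 + w) < u^2 b (2 X - 1)] with [w := s u], which is
    [rho + th < 4 mu - 6] for [th := (1 + w) / w] and
    [rho := u^2 b / (w (1 + w))].  As [rho * th = b / a], the inequality of
    arithmetic and geometric means yields [a (mu - 3/2)^2 > b / 4] and
    [mu >= 2], because [b / a >= 2]. *)
Lemma contradicts_second_inequality {R : realFieldType} (N M s u d F X : R) :
  let a := s ^+ 2 in let b := 1 + a in
  3 <= N -> 0 < s <= 1 -> 1 <= u -> u = N * s ^+ 3 -> 0 <= F ->
  F * (2 * (7 * N + 1 + 2 * u ^+ 2 * (2 * N - 1))) = 7 * N + 1 ->
  b * d = (u - s) ^+ 2 * F -> X * N * b ^+ 2 = 2 * M * (1 + s * u) ->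
  (2 - d) ^+ 2 < X ->
  2 * b <= a * M /\
  b ^+ 2 * (1 / 4 - 2 * a) + 3 * a ^+ 2 * b * M - a ^+ 3 * M ^+ 2 < 0.
Proof.
move=> a b N3 sI u1 uE F0 FE dE XE dX.
have K := defect_bound N s u F N3 sI u1 uE F0 FE.
have /andP[s0 s1] := sI.
have a0 : 0 < a by apply: exprn_gt0.
have a1 : a <= 1 by rewrite exprn_ile1 // ltW.
have b0 : 0 < b by rewrite /b; lra.
have u0 : 0 < u by lra.
have [w wE] : {w | w = s * u} by exists (s * u).
have w0 : 0 < w by rewrite wE mulr_gt0.
have w1 : 0 < 1 + w by lra.
(* The tangent line of [p^2] at [p = 7/4] keeps the bound linear in [d]. *)
have XB : 55 / 8 - 7 * d < 2 * X - 1.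
  by have := sqr_ge0 (2 - d - 7 / 4); lra.
have main : (7 * w + 1) * (1 + w) < u ^+ 2 * b * (2 * X - 1).
  apply: le_lt_trans (_ : u ^+ 2 * b * (55 / 8 - 7 * d) < _); last first.
    by rewrite ltr_pM2l // mulr_gt0 // exprn_gt0.
  rewrite mulrBr [X in _ - X](_ : _ = 7 * u ^+ 2 * (b * d)); last by ring.
  by rewrite dE wE /b /a; lra.
pose mu := a * M / b; pose th := (1 + w) / w; pose rho := u ^+ 2 * b / (w * (1 + w)).
have ME : a * M = b * mu by rewrite /mu; field; rewrite gt_eqF.
have rho0 : 0 < rho by rewrite divr_gt0 // mulr_gt0 // exprn_gt0.
have th0 : 0 < th by rewrite divr_gt0.
have rhoth : a * (rho * th) = b.
  have -> : a * (rho * th) = (s * u) ^+ 2 * b / w ^+ 2.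
    by rewrite /rho /th /a; field; rewrite !gt_eqF.
  by rewrite -wE; field; rewrite gt_eqF.
have muE : 2 * w * (1 + w) * mu = u ^+ 2 * b * X.
  have : 2 * s ^+ 3 * M * (1 + s * u) = X * b ^+ 2 * u.
    rewrite (_ : _ * M * _ = s ^+ 3 * (2 * M * (1 + s * u))); last by ring.
    by rewrite -XE uE; ring.
  rewrite -wE => H; rewrite /mu {1}wE /a.
  have -> : 2 * (s * u) * (1 + w) * (s ^+ 2 * M / b) =
      u * (2 * s ^+ 3 * M * (1 + w)) / b by field; rewrite gt_eqF.
  by rewrite H; field; rewrite gt_eqF.
have mu_gt : rho + th < 4 * mu - 6.
  rewrite -(@ltr_pM2l _ (w * (1 + w))) ?mulr_gt0 //.
  have -> : w * (1 + w) * (rho + th) = u ^+ 2 * b + (1 + w) ^+ 2.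
    by rewrite /rho /th; field; rewrite !gt_eqF.
  lra.
have amgm : 4 * b <= a * (rho + th) ^+ 2.
  rewrite -rhoth -subr_ge0.
  rewrite (_ : _ - _ = a * (rho - th) ^+ 2); last by ring.
  by rewrite mulr_ge0 ?sqr_ge0 // ltW.
have rt0 : 0 < rho + th by exact: addr_gt0.
have rt2 : 2 <= rho + th.
  rewrite leNgt; apply/negP => lt2.
  have : (rho + th) ^+ 2 < 4.
    by rewrite (_ : 4 = 2 ^+ 2) ?ltr_sqr ?nnegrE ?ltW //; ring.
  rewrite -(ltr_pM2l a0); move: amgm; rewrite /b; lra.
split; first by rewrite ME mulrC ler_pM2l //; lra.
have sq : (rho + th) ^+ 2 < (4 * mu - 6) ^+ 2.
  by rewrite ltr_sqr ?nnegrE //; lra.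
have {}sq : 4 * b < a * (4 * mu - 6) ^+ 2.
  by apply: le_lt_trans amgm _; rewrite ltr_pM2l.
rewrite (_ : _ - _ = b ^+ 2 * (b / 4 - a * (mu - 3 / 2) ^+ 2)).
  by rewrite pmulr_rlt0 ?exprn_gt0 //; lra.
rewrite (_ : a ^+ 3 * M ^+ 2 = a * (a * M) ^+ 2); last by ring.
rewrite (_ : 3 * a ^+ 2 * b * M = 3 * a * b * (a * M)); last by ring.
by rewrite ME /b; field.
Qed.

(** * The bound for finite families *)

(** The factored form of [2 - p]; with [a = -t] it reads
    [a (n a - 1)^2 (7 n + 1) / (2 (1 + a) D)] with [D > 0]. *)
Definition defect {R : realType} (n : nat) (t : R) : R :=
  let N : R := n%:R in
  - t * (N * t + 1) ^+ 2 * (7 * N + 1)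
    / (2 * (1 - t) * (1 + 7 * N - 2 * N ^+ 2 * t ^+ 3 * (2 * N - 1))).

Lemma pbound_den_gt0 {R : realType} (n : nat) (t : R) :
  (3 <= n)%N -> -1 <= t <= 0 ->
  0 < 1 + 7 * n%:R - 2 * n%:R ^+ 2 * t ^+ 3 * (2 * n%:R - 1).
Proof.
move=> n3 /andP[_ t0]; have N3 : (3 : R) <= n%:R by rewrite ler_nat.
move: (n%:R : R) N3 => N N3.
have t3 : 0 <= (- t) ^+ 3 by rewrite exprn_ge0 // oppr_ge0.
have : 0 <= 2 * N ^+ 2 * (- t) ^+ 3 * (2 * N - 1).
  by rewrite !mulr_ge0 ?sqr_ge0 //; lra.
lra.
Qed.

Lemma pboundE {R : realType} (n : nat) (t : R) :
  (3 <= n)%N -> -1 <= t <= 0 -> pbound n t = 2 - defect n t.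
Proof.
move=> n3 tI; have D0 := pbound_den_gt0 n t n3 tI.
have /andP[_ t0] := tI; rewrite /pbound /defect.
move: (n%:R : R) D0 => N D0; field.
by rewrite !gt_eqF //; lra.
Qed.

(** If [m > f(n,t)] then [p^2 < X], and the sign of [u - 1] decides which of the
    two trace inequalities is violated.  At [t = 0] both [s] and [u] vanish, and
    the first one applies. *)
Lemma family_size_le_fbound {R : realType} {m n : nat} (t : R)
    (x : 'I_m -> 'rV[R]_n) :
  (3 <= n)%N -> -1 <= t <= 0 ->
  (forall i, dotp (x i) (x i) = 1) ->
  (forall i j k, i != j -> i != k -> j != k ->
    [\/ t = dotp (x i) (x j), t = dotp (x i) (x k) | t = dotp (x j) (x k)]) ->
  m%:R <= fbound n t.
Proof.
move=> n3 tI x1 xt; rewrite leNgt; apply/negP => fm.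
have ineq c := almost_equiangular_family_inequality t c x x1 xt tI.
have D0 := pbound_den_gt0 n t n3 tI.
have M0 : 0 < m%:R :> R.
  have nt2 : 0 <= n%:R * t ^+ 2 by rewrite mulr_ge0 ?sqr_ge0.
  apply: le_lt_trans fm; apply: divr_ge0; last by lra.
  by rewrite (mulr_ge0 (mulr_ge0 (sqr_ge0 _) _) (sqr_ge0 _)).
move: fm; rewrite /fbound pboundE //.
have N3 : (3 : R) <= n%:R by rewrite ler_nat.
rewrite /defect; move: (n%:R : R) (m%:R : R) N3 M0 ineq D0 => N M N3 M0 ineq D0.
have /andP[t1 t0] := tI.
pose s := Num.sqrt (- t).
have s2 : s ^+ 2 = - t by rewrite sqr_sqrtr // oppr_ge0.
have tE : t = - s ^+ 2 by rewrite s2 opprK.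
have s0 : 0 <= s by exact: sqrtr_ge0.
have s1 : s <= 1 by rewrite -sqrtr1 ler_wsqrtr //; lra.
pose u := N * s ^+ 3; pose b := 1 + s ^+ 2.
have b0 : 0 < b by rewrite /b; have := sqr_ge0 s; lra.
have u0 : 0 <= u by rewrite mulr_ge0 ?exprn_ge0 //; lra.
have su0 : 0 <= s * u by exact: mulr_ge0.
pose D := 7 * N + 1 + 2 * u ^+ 2 * (2 * N - 1).
have DE : 1 + 7 * N - 2 * N ^+ 2 * t ^+ 3 * (2 * N - 1) = D.
  by rewrite tE /D /u; ring.
rewrite DE in D0 *.
pose F := (7 * N + 1) / (2 * D).
have F0 : 0 <= F by rewrite divr_ge0 //; lra.
have FE : F * (2 * D) = 7 * N + 1 by rewrite divfK // gt_eqF //; lra.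
have F2 : 2 * F <= 1.
  rewrite -(ler_pM2r D0); have : 0 <= u ^+ 2 * (2 * N - 1).
    by rewrite mulr_ge0 ?sqr_ge0 //; lra.
  by move: FE; rewrite /D; lra.
set d := _ / (2 * (1 - t) * D) => fm.
have bE : 1 - t = b by rewrite tE /b; ring.
have dE : b * d = (u - s) ^+ 2 * F.
  rewrite /d bE /F /u tE; field.
  by rewrite !gt_eqF.
pose X := 2 * M * (1 + s * u) / (N * b ^+ 2).
have Nb0 : 0 < N * b ^+ 2 by rewrite mulr_gt0 ?exprn_gt0 //; lra.
have XE : X * N * b ^+ 2 = 2 * M * (1 + s * u).
  by rewrite -mulrA divfK // gt_eqF.
have dX : (2 - d) ^+ 2 < X.
  rewrite ltr_pdivlMr //; move: fm; rewrite ltr_pdivrMr; last first.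
    by have /mulr_ge0/(_ (sqr_ge0 t)) : 0 <= N by [lra]; lra.
  by rewrite bE /u tE; lra.
have [u1|u1] := lerP u 1.
  have s01 : 0 <= s <= 1 by rewrite s0.
  have u01 : 0 <= u <= 1 by rewrite u0.
  have N0 : 0 < N by lra.
  have lt := contradicts_first_inequality N M s u d F X
    N0 s01 u01 erefl F2 dE XE dX.
  have [c3 mu_ge] : 3 <= 2 * (2 : R) /\ 4 * (1 - t) * (2 - 2) <= - t * M.
    by have := mulr_ge0 (sqr_ge0 s) (ltW M0); rewrite s2; split; lra.
  have := ineq 2 c3 mu_ge; rewrite bE tE; move: lt; rewrite -(ltr_pM2r M0).
  by rewrite -/b; lra.
have sp : 0 < s <= 1.
  rewrite s1 andbT lt0r s0 andbT; apply/eqP => s_eq0.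
  by move: u1; rewrite /u s_eq0 expr0n mulr0 ltr10.
have [mu_ge neg] := contradicts_second_inequality N M s u d F X
  N3 sp (ltW u1) erefl F0 FE dE XE dX.
have [c3 mu_ge'] : 3 <= 2 * (3 / 2 : R) /\ 4 * (1 - t) * (2 - 3 / 2) <= - t * M.
  by split; [|move: mu_ge; rewrite tE]; lra.
have := ineq (3 / 2) c3 mu_ge'; rewrite (_ : _ * (1 - t) * M ^+ 2 = 0); last by field.
rewrite pmulr_rge0 ?mulr_gt0 //; last by lra.
by rewrite tE; move: neg; lra.
Qed.

(** * Comparison with the bound independent of the dimension *)

Lemma bernstein_ge0 {R : realFieldType} (lo hi a : R) (i j : nat) :
  lo <= a <= hi -> 0 <= (a - lo) ^+ i * (hi - a) ^+ j.
Proof.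
by move=> /andP[la ah]; rewrite mulr_ge0 // exprn_ge0 // subr_ge0.
Qed.

(** Proves a univariate polynomial inequality on an interval [I] by a linear
    combination of the Bernstein polynomials of degree [j], with the polynomials
    of index less than [i] already in the context. *)
Ltac bernstein_from i j I :=
  have ? := bernstein_ge0 _ _ _ i j I;
  lazymatch j with
  | O => lra
  | S ?j' => bernstein_from (S i) j' I
  end.

Ltac bernstein degree I := bernstein_from 0%N degree I.

(** At [N = 3] the two sides differ by a factor of about 1.001 near
    [a = 19/20], and the Bernstein coefficients are nonnegative only after the
    unit interval is split. *)
Lemma limit_inequality_dim34 {R : realFieldType} (N a B D H : R) :
  N = 3 \/ N = 4 -> 0 <= a <= 1 ->
  B = 9 + 16 * a -> D = 7 * N + 1 + 2 * N ^+ 2 * a ^+ 3 * (2 * N - 1) ->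
  H = 49 * N + 7 + 56 * a ^+ 2 * N ^+ 2 - 28 * a * N - 18 * a ^+ 3 * N ^+ 2
      + 8 * a ^+ 2 * N - 4 * a ->
  N * a ^+ 2 * (B * D + H) ^+ 2 <= B ^+ 2 * D ^+ 2 * (1 + N * a ^+ 2).
Proof.
move=> N34 /andP[a0 a1] -> -> ->.
have [a45|a45] := lerP a (4 / 5).
  have I : 0 <= a <= 4 / 5 by rewrite a0.
  case: N34 => ->; bernstein 9%N I.
have I : 4 / 5 <= a <= 1 by rewrite ltW.
case: N34 => ->; bernstein 9%N I.
Qed.

(** With [w = N a^2], this is the estimate [H / (B D) <= 2 / (4 w + 1)], where
    [(4 w + 3) / (4 w + 1) <= sqrt (1 + 1 / w)]; it is false for [N = 3].  In
    powers of [V = N - 5], the constant term is nonnegative and the rest is [V]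
    times a quadratic polynomial in [V] with nonnegative values. *)
Lemma limit_inequality_dim_ge5 {R : realFieldType} (N a B D H : R) :
  5 <= N -> 0 <= a <= 1 ->
  B = 9 + 16 * a -> D = 7 * N + 1 + 2 * N ^+ 2 * a ^+ 3 * (2 * N - 1) ->
  H = 49 * N + 7 + 56 * a ^+ 2 * N ^+ 2 - 28 * a * N - 18 * a ^+ 3 * N ^+ 2
      + 8 * a ^+ 2 * N - 4 * a ->
  (4 * N * a ^+ 2 + 1) * H <= 2 * B * D.
Proof.
move=> N5 /andP[a0 a1] -> -> ->.
have [V VE] : {V | N = 5 + V} by exists (N - 5); ring.
have V0 : 0 <= V by lra.
pose c0 := 2 * (9 + 16 * a) * (36 + 450 * a ^+ 3)
  - (20 * a ^+ 2 + 1) * (252 - 144 * a + 40 * 36 * a ^+ 2 - 450 * a ^+ 3).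
pose c1 := 77 + 252 * a - 36 * 71 * a ^+ 2 + 28 * 227 * a ^+ 3
  - 80 * 102 * a ^+ 4 + 54 * 100 * a ^+ 5.
pose q := 252 - 2 * 587 * a + 32 * 48 * a ^+ 2 - 30 * 36 * a ^+ 3.
pose c3 := 72 - 96 * a + 72 * a ^+ 2.
rewrite -subr_ge0
  (_ : _ - _ = c0 + V * (c1 - a ^+ 2 * q * V + a ^+ 3 * c3 * V ^+ 2)); last first.
  by rewrite VE /c0 /c1 /q /c3; ring.
have [c0_ge0 c1_ge0] : 0 <= c0 /\ 0 <= c1.
  rewrite /c0 /c1; have [a2|a2] := lerP a (1 / 2).
    have I : 0 <= a <= 1 / 2 by rewrite a0.
    split; bernstein 5%N I.
  have I : 1 / 2 <= a <= 1 by rewrite ltW.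
  split; bernstein 5%N I.
have c3_ge : 40 <= c3 by have := sqr_ge0 (3 * a - 2); rewrite /c3; lra.
rewrite addr_ge0 // mulr_ge0 //.
have a30 : 0 <= a ^+ 3 * V ^+ 2 by rewrite mulr_ge0 ?exprn_ge0.
have c3V : a ^+ 3 * V ^+ 2 * 40 <= a ^+ 3 * V ^+ 2 * c3 by rewrite ler_wpM2l.
(* The coefficient of [V] in the quadratic factor is negative only for small
   [a], where a discriminant bound applies. *)
have [a2|a2] := lerP a (2 / 5).
  have I : 0 <= a <= 2 / 5 by rewrite a0.
  have qc : a * q ^+ 2 / 160 <= c1.
    by rewrite /q /c1; bernstein 7%N I.
  have : 0 <= a * (80 * (a * V) - q) ^+ 2 by rewrite mulr_ge0 ?sqr_ge0.
  lra.
have q0 : q <= 0.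
  rewrite /q; have I : 2 / 5 <= a <= 1 by rewrite ltW.
  bernstein 5%N I.
have : 0 <= a ^+ 2 * V * - q by rewrite !mulr_ge0 ?sqr_ge0 ?oppr_ge0.
lra.
Qed.

(** One has [8 p (1 - t) D = B D + H] with [B := 9 - 16 t], so that the claim is
    [N a^2 (B D + H)^2 <= B^2 D^2 (1 + N a^2)].  For fixed [a > 0] the ratio
    [H / D] tends to 0 as [N] grows, and the two sides become asymptotically
    equal: this is where the right-hand bound comes from. *)
Lemma fbound_le_dimension_free {R : realType} (n : nat) (t : R) :
  (3 <= n)%N -> -1 <= t <= 0 -> t != 0 ->
  fbound n t <= (16 * t - 9) ^+ 2 / (128 * t ^+ 2).
Proof.
move=> n3 tI t_neq0; rewrite /fbound pboundE // /defect.
have N3 : [\/ n%:R = 3 :> R, n%:R = 4 :> R | 5 <= n%:R :> R].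
  case: n n3 => [|[|[|[|[|n]]]]] // _; [by constructor 1|by constructor 2|].
  by constructor 3; rewrite ler_nat.
have D0 := pbound_den_gt0 n t n3 tI.
have /andP[t1 t0] := tI.
move: (n%:R : R) D0 N3 => N D0 N3.
have N3' : 3 <= N by case: N3 => ?; lra.
have [a aE] : {a : R | t = - a} by exists (- t); rewrite opprK.
have aI : 0 <= a <= 1 by lra.
have a0 : 0 < a.
  by rewrite lt0r -oppr_eq0 -aE t_neq0; case/andP: aI.
have w0 : 0 <= N * a ^+ 2 by rewrite mulr_ge0 ?sqr_ge0 //; lra.
pose D := 7 * N + 1 + 2 * N ^+ 2 * a ^+ 3 * (2 * N - 1).
have DE : 1 + 7 * N - 2 * N ^+ 2 * t ^+ 3 * (2 * N - 1) = D.
  by rewrite aE /D; ring.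
pose B := 9 + 16 * a.
pose H := 49 * N + 7 + 56 * a ^+ 2 * N ^+ 2 - 28 * a * N - 18 * a ^+ 3 * N ^+ 2
      + 8 * a ^+ 2 * N - 4 * a.
rewrite DE in D0 *.
have B0 : 0 < B by rewrite /B; lra.
have BD0 : 0 < B * D by exact: mulr_gt0.
set d := _ / (2 * (1 - t) * D).
have pE : (2 - d) * (1 - t) * (8 * D) = B * D + H.
  rewrite /d aE opprK /B /H /D; field.
  by rewrite !gt_eqF //; lra.
have main : N * a ^+ 2 * (B * D + H) ^+ 2 <= B ^+ 2 * D ^+ 2 * (1 + N * a ^+ 2).
  case: N3 => [N3|N4|N5].
  - by apply: limit_inequality_dim34 => //; left.
  - by apply: limit_inequality_dim34 => //; right.
  have H1 : (4 * N * a ^+ 2 + 1) * H <= 2 * B * D by apply: limit_inequality_dim_ge5.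
  (* The estimate on [H] is squared below, which requires [p >= 0]. *)
  have BDH : 0 <= B * D + H.
    have a3 : 0 <= 36 * (N ^+ 2 * a ^+ 3 * (N - 1)).
      by rewrite !mulr_ge0 ?sqr_ge0 ?exprn_ge0 //; lra.
    have aD : 0 <= a * D by rewrite mulr_ge0 // ltW.
    have aN : 0 <= 8 * (N * a ^+ 2) * (7 * N + 1) by rewrite !mulr_ge0 //; lra.
    have a1N : 0 <= (1 - a) * (7 * N + 1) by rewrite mulr_ge0 //; lra.
    by move: aD; rewrite /B /H /D; lra.
  set w := N * a ^+ 2 in w0 *.
  have H2 : (4 * w + 1) * (B * D + H) <= (4 * w + 3) * (B * D).
    by move: H1; rewrite /w; lra.
  have {}H2 : ((4 * w + 1) * (B * D + H)) ^+ 2 <= ((4 * w + 3) * (B * D)) ^+ 2.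
    by rewrite ler_sqr ?nnegrE // mulr_ge0 //; lra.
  have w1 : 0 < (4 * w + 1) ^+ 2 by rewrite exprn_gt0 //; lra.
  rewrite -(ler_pM2l w1).
  have := ler_wpM2l w0 H2; have := sqr_ge0 (B * D); lra.
rewrite ler_pdivrMr; last by rewrite aE; lra.
rewrite [leRHS]mulrAC ler_pdivlMr; last first.
  by rewrite mulr_gt0 // aE sqrrN exprn_gt0.
have D2 : 0 < D ^+ 2 by rewrite exprn_gt0.
rewrite -(ler_pM2r D2).
have -> : (2 - d) ^+ 2 * N * (1 - t) ^+ 2 * (128 * t ^+ 2) * D ^+ 2 =
   2 * (N * a ^+ 2 * ((2 - d) * (1 - t) * (8 * D)) ^+ 2).
  by rewrite aE; ring.
rewrite pE aE /B in main *; lra.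
Qed.

(** * Existence of the maximum *)

Section Cardinality.

Local Open Scope classical_set_scope.
Local Open Scope card_scope.

Lemma almost_equiangular_card_le_fbound {R : realType} {n m : nat} (t : R)
    (S : set 'rV[R]_n) :
  (3 <= n)%N -> -1 <= t <= 0 -> almost_equiangular t S -> `I_m #<= S ->
  m%:R <= fbound n t.
Proof.
move=> n3 tI [unitS tS] /card_leP[f].
pose x (i : 'I_m) : 'rV[R]_n :=
  val (f (SigSub (mem_set (ltn_ord i) : (i : nat) \in `I_m))).
have Sx i : S (x i) by apply: set_valP.
have x_inj : injective x.
  move=> i j /val_inj /(@inj _ _ _ f); rewrite !in_setT => /(_ isT isT).
  by move=> /(congr1 val) /= /ord_inj.
apply: (family_size_le_fbound t x) => //.
- move=> i; have := unitS _ (Sx i); rewrite /unit_sphere /enorm /=.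
  move=> /(congr1 (fun y => y ^+ 2)); rewrite expr1n sqr_sqrtr //.
  by apply: sumr_ge0 => k _; rewrite -expr2 sqr_ge0.
- move=> i j k ij ik jk.
  by apply: tS => // /x_inj /eqP; apply/negP.
Qed.

Lemma alpha_is_max_cardinality {R : realType} (n : nat) (t : R) :
  (3 <= n)%N -> -1 <= t <= 0 -> is_max_cardinality n t (alpha n t).
Proof.
move=> hn ht.
have bound m (S : set 'rV[R]_n) : almost_equiangular t S -> `I_m #<= S ->
    m%:Z <= Num.floor (fbound n t).
  move=> Sae mS; rewrite floor_ge_int.
  by have := almost_equiangular_card_le_fbound t S hn ht Sae mS.
pose P m := `[< exists S : set 'rV[R]_n, almost_equiangular t S /\ S #= `I_m >].
have exP : exists m, P m.
  by exists 0%N; apply/asboolP; exists set0; split; [split | rewrite II0].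
have ubP m : P m -> (m <= `|Num.floor (fbound n t)|)%N.
  move=> /asboolP[S [Sae /card_eqPle[_ mS]]].
  by have := bound m S Sae mS; lia.
have finS (S : set 'rV[R]_n) : almost_equiangular t S -> finite_set S.
  move=> Sae; apply: contrapT => /infiniteP natS.
  have := bound `|Num.floor (fbound n t)|.+1 S Sae
    (card_le_trans (subset_card_le (@subsetT _ _)) natS).
  lia.
have max : is_max_cardinality n t (ex_maxn exP ubP).
  case: ex_maxnP => m /asboolP[S Sm] mmax; split; first by exists S.
  move=> S' S'ae; have /finite_setP[k S'k] := finS S' S'ae.
  rewrite (card_le_eql S'k) card_le_II; apply: mmax.
  by apply/asboolP; exists S'.
by apply: (xgetPex 0%N); exists (ex_maxn exP ubP).
Qed.

End Cardinality.

Theorem theorem1p1 (R : realType) (n : nat) (t : R)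
    (hn : (3 <= n)%N) (ht : -1 <= t <= 0) :
  [/\ is_max_cardinality n t (alpha n t),
      (alpha n t)%:Z <= Num.floor (fbound n t)
    & t != 0 ->
      Num.floor (fbound n t)
        <= Num.floor ((16 * t - 9) ^+ 2 / (128 * t ^+ 2))].
Proof.
have alpha_max := alpha_is_max_cardinality n t hn ht.
split => //; last by move=> t0; apply: le_floor; apply: fbound_le_dimension_free.
have [[S [Sae /card_eqPle[_ mS]]] _] := alpha_max.
rewrite floor_ge_int.
by have := almost_equiangular_card_le_fbound t S hn ht Sae mS.
Qed.
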